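(* Let $a<b$ be real numbers and let $h,g:[a,b)\to\mathbb{R}$ be continuous functions such that $h$ is increasing and is not constant on any neighborhood of $a$, and suppose the limit $\lim_{x\to a}\frac{g(x)-g(a)}{h(x)-h(a)}$ exists and is finite. For $x\in(a,b)$ let $\mu(x)$ be the supremum of the set of numbers $\tau\in(a,x]$ that are points of local extremum of the function $t\mapsto \bigl(g(x)-g(a)\bigr)h(t)-\bigl(h(x)-h(a)\bigr)g(t)$, $t\in[a,b)$. Let $$C=\overline{\lim_{x\to a}}\operatorname{ess}\frac{h(x)-h(a)}{(x-a)\,h'(x)}\in[0,+\infty].$$ Then $$\varlimsup_{x\to a}\frac{\mu(x)-a}{x-a}\ \geq\ e^{-C}.$$ If, in addition, $h$ and $g$ are differentiable on $(a,b)$ with $h'(t)>0$ for all $t\in(a,b)$, and for $x\in(a,b)$ $\xi(x)$ denotes the supremum of the numbers $\tau\in(a,x)$ with $\frac{g(x)-g(a)}{h(x)-h(a)}=\frac{g'(\tau)}{h'(\tau)}$, then also $$\varlimsup_{x\to a}\frac{\xi(x)-a}{x-a}\ \geq\ e^{-C}.$$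
   Context: An increasing function is differentiable almost everywhere, so $h'(x)$ is defined for almost all $x$. For a function $f$ defined almost everywhere on $[a,b)$, the essential upper limit $\overline{\lim_{x\to a}}\operatorname{ess} f(x)$ is the greatest lower bound of the numbers $t\in\mathbb{R}$ such that $f(x)\le t$ for almost all $x$ in some interval $[a,\delta]\subset[a,b)$ (it equals $+\infty$ if there is no such $t$). The convention $e^{-\infty}=0$ is used. Limits at $a$ are right-hand limits. *)

(* Defs.v *)
From HB Require Import structures.
From mathcomp Require Import all_boot all_order all_algebra.
From mathcomp Require Import all_classical all_reals all_analysis.
Set Implicit Arguments. Unset Strict Implicit. Unset Printing Implicit Defensive.
Import Order.TTheory GRing.Theory Num.Theory.
Import numFieldNormedType.Exports.
Local Open Scope classical_set_scope.
Local Open Scope ring_scope.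

Section defs.
Context {R : realType}.

Definition is_local_extremum (D : set R) (F : R -> R) (t : R) : Prop :=
  (exists2 e : R, 0 < e & forall s, D s -> `|s - t| < e -> F s <= F t) \/
  (exists2 e : R, 0 < e & forall s, D s -> `|s - t| < e -> F t <= F s).

Definition mu_fun (a b : R) (h g : R -> R) (x : R) : R :=
  sup [set tau | a < tau <= x /\
        is_local_extremum `[a, b[%classic
          (fun t => (g x - g a) * h t - (h x - h a) * g t) tau].

Definition xi_fun (a : R) (h g : R -> R) (x : R) : R :=
  sup [set tau | a < tau < x /\
        (g x - g a) / (h x - h a) = derive1 g tau / derive1 h tau].

Definition ess_quot (a : R) (h : R -> R) (x : R) : \bar R :=
  if derive1 h x == 0 then +oo%E else ((h x - h a) / ((x - a) * derive1 h x))%:E.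

(* essential upper limit at a (from the right) of ess_quot, where defined
   (i.e. where h is differentiable); inf of the empty set is +oo *)
Definition C_const (a b : R) (h : R -> R) : \bar R :=
  ereal_inf [set t%:E | t in [set t : R | exists2 d : R, a < d < b &
     {ae (@lebesgue_measure R), forall x, a <= x <= d ->
        derivable h x 1 -> (ess_quot a h x <= t%:E)%E}]].

End defs.

(* Main.v *)
Require Import Defs.
From HB Require Import structures.
From mathcomp Require Import all_boot all_order all_algebra.
From mathcomp Require Import all_classical all_reals all_analysis.
From mathcomp Require Import unstable measurable_realfun ring lra.
Set Implicit Arguments. Unset Strict Implicit. Unset Printing Implicit Defensive.
Import Order.TTheory GRing.Theory Num.Theory.
Import numFieldNormedType.Exports.
Local Open Scope classical_set_scope.
Local Open Scope ring_scope.

(** Normalise h(a) = g(a) = 0, put f = g / h, F_x(t) = g(x) h(t) - h(x) g(t),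
  and suppose that the upper limit is < q < e^(-C).  Then for x near a, F_x has
  no local extremum in (a + q (x - a), x), hence is strictly monotone there.
  As F_x(t) = h(x) h(t) (f(x) - f(t)), f is locally injective, hence strictly
  monotone near a, say increasing.  Monotonicity of F_x then reads
  (f(x) - f(t)) dh(t) <= h(t) df(t) whenever a + q (x - a) < t <= x.  On the
  other hand the bound on (h - h(a)) / ((x - a) h') gives
  h(a + q (x - a)) < e^(-r) h(x) for some r > 1, so in the variable u = ln h
  the inequality becomes the advanced one f' (u) >= f(u + r) - f(u).
  Integrating it from -oo, where f has a finite limit L, to u yields
  f(u) - L >= r (f(u) - L), which is absurd.  The integration is carried out on
  a sequence along which h is geometric.

  A bound on h' almost everywhere where h is differentiable controls the
  increments of h because H = id + h has a 1-Lipschitz inverse, whose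
  derivative is the Radon-Nikodym density of the image of Lebesgue measure
  under H. *)

(** * Increments of monotone functions *)

Section expansive.
Context {R : realType} (H : R -> R).
Hypothesis H_expand : forall x y, x <= y -> y - x <= H y - H x.
Hypothesis H_cont : continuous H.
Notation lambda := (@lebesgue_measure R).

Lemma expansive_lt x y : x < y -> H x < H y.
Proof. by move=> xy; have := H_expand (ltW xy); lra. Qed.

Lemma expansive_le_mono : {mono H : x y / x <= y}.
Proof. by apply: le_mono => x y; exact: expansive_lt. Qed.

Lemma expansive_surj y : exists x, H x = y.
Proof.
pose M := `|y - H 0|.
have M0 : 0 <= M by exact: normr_ge0.
have yM : Num.min (H (- M)) (H M) <= y <= Num.max (H (- M)) (H M).
  have := @H_expand (- M) 0; have := @H_expand 0 M.
  have := ler_norm (y - H 0); have := lerNnormlW (lexx `|y - H 0|).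
  rewrite -/M => ? ? ? ?.
  by rewrite ge_min le_max; apply/andP; split; apply/orP; [left|right]; lra.
have MM : - M <= M by lra.
by have [x _ <-] := IVT MM (continuous_subspaceT H_cont) yM; exists x.
Qed.

Lemma expansive_measurable : measurable_fun setT H.
Proof. exact: continuous_measurable_fun. Qed.

Lemma expansive_preimage_itvoc c d :
  (lambda (H @^-1` `]c, d]) <= lambda `]c, d])%E.
Proof.
have [c' <-] := expansive_surj c; have [d' <-] := expansive_surj d.
have -> : H @^-1` `]H c', H d'] = `]c', d']%classic.
  apply/seteqP; split=> x /=; rewrite !in_itv/= expansive_le_mono;
  by rewrite (leW_mono expansive_le_mono).
rewrite !lebesgue_measure_itv/= !lte_fin (leW_mono expansive_le_mono).
by case: ifPn => // cd; rewrite !EFinN -!EFinD lee_fin; apply/H_expand/ltW.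
Qed.

(** Cover A by half-open intervals of total length below lambda A + e: their preimages are no longer
    and cover the preimage of A. *)
Lemma expansive_preimage_le A : measurable A ->
  (lambda (H @^-1` A) <= lambda A)%E.
Proof.
move=> mA.
have mHA (B : set R) : measurable B -> measurable (H @^-1` B).
  by move=> mB; rewrite -[X in measurable X]setTI; exact: expansive_measurable.
have [->|Afin] := eqVneq (lambda A) +oo%E; first exact: leey.
apply/lee_addgt0Pr => e e0.
have /ereal_inf_lt[z [/= M covAM sMz zAe]] : (lambda A < lambda A + e%:E)%E.
  by rewrite lte_spaddre ?lte_fin// ge0_fin_numE// ltey.
apply: ltW; apply: le_lt_trans zAe; rewrite -sMz.
apply: (@le_trans _ _ (\sum_(n <oo) lambda (H @^-1` M n))%E).
  apply: (@measure_sigma_subadditive _ R _ lambda (H @^-1` A)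
    (fun n => H @^-1` M n)).
  - move=> n; apply: mHA; apply: sub_sigma_algebra.
    by case: covAM => /(_ n).
  - exact: mHA.
  - by rewrite -preimage_bigcup; apply: preimage_subset; case: covAM.
apply: lee_nneseries => // n _.
have /ocitvP[->|[[c d] /= cd ->]] : ocitv (M n) by case: covAM => /(_ n).
  by rewrite preimage_set0 !measure0.
apply: (le_trans (expansive_preimage_itvoc c d)).
by rewrite lebesgue_measure_itv/= wlength_itv.
Qed.
End expansive.

(** * The image of Lebesgue measure under an expansive map *)

Section pushforward_expansive.
Context {R : realType} (H : R -> R) (a b : R).
Hypothesis H_expand : forall x y, x <= y -> y - x <= H y - H x.
Hypothesis H_cont : continuous H.
Hypothesis ab : a < b.
Notation lambda := (@lebesgue_measure R).

(** Image under H of Lebesgue measure on [[a, b]]. Being dominated by [lambda] it has a density,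
    which stands in for the derivative of the inverse of H. *)
Let nu (A : set (measurableTypeR R)) : \bar R := lambda (H @^-1` A `&` `[a, b]).

Let preimage_H_measurable (B : set (measurableTypeR R)) :
  measurable B -> measurable (H @^-1` B : set (measurableTypeR R)).
Proof.
by move=> mB; rewrite -[X in measurable X]setTI;
  exact: expansive_measurable.
Qed.

Let nu0 : nu set0 = 0%E.
Proof. by rewrite /nu preimage_set0 set0I measure0. Qed.

Let nu_ge0 A : (0 <= nu A)%E.
Proof. exact: measure_ge0. Qed.

Let nu_sigma_additive : semi_sigma_additive nu.
Proof.
move=> F mF tF mUF; rewrite /nu preimage_bigcup setI_bigcupl.
apply: measure_semi_sigma_additive.
- move=> n; apply: measurableI => //. exact: preimage_H_measurable.
- apply/trivIsetP => i j _ _ ij; rewrite setIACA -preimage_setI.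
  by move/trivIsetP : tF => /(_ _ _ _ _ ij) ->//; rewrite preimage_set0 set0I.
- rewrite -setI_bigcupl -preimage_bigcup.
  by apply: measurableI => //; exact: preimage_H_measurable.
Qed.

HB.instance Definition _ := isMeasure.Build _ _ _ nu nu0 nu_ge0 nu_sigma_additive.

Let nu_fin : fin_num_fun nu.
Proof.
move=> A mA; rewrite ge0_fin_numE//.
apply: (@le_lt_trans _ _ (lambda `[a, b]%classic)).
  apply: le_measure; rewrite ?inE//.
  by apply: measurableI => //; exact: preimage_H_measurable.
by rewrite lebesgue_measure_itv/=; case: ifP => // _; rewrite -EFinB ltry.
Qed.

HB.instance Definition _ := Measure_isFinite.Build _ _ _ nu nu_fin.

Let nu_dominated : nu `<< lambda.
Proof.
apply/null_content_dominatesP => A mA A0.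
apply/eqP; rewrite -measure_le0 /=.
apply: (@le_trans _ _ (lambda (H @^-1` A))).
  apply: le_measure; rewrite ?inE//; last exact: preimage_H_measurable.
  by apply: measurableI => //; exact: preimage_H_measurable.
by rewrite -A0; exact: expansive_preimage_le.
Qed.

(** For almost every x in []a, b[] the density of [nu] at H x is either 0 or 1 / H'(x), hence at
    most 1 / k. Integrating it over the image of [[a, b]] bounds b - a by (H b - H a) / k. *)
Lemma expansive_ae_derive_ge (k : R) : 0 < k ->
  {ae lambda, forall x, a < x < b -> derivable H x 1 -> k <= derive1 H x} ->
  k * (b - a) <= H b - H a.
Proof.
move=> k0 [N [mN N0 subN]].
have [gam [gam0 gamfin gamint nuE]] :=
  @radon_nikodym_sigma_finite _ _ _ lambda nu nu_dominated.
pose g := fine \o gam.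
have gE : EFin \o g = gam by apply/funext => x; rewrite /g /= fineK.
have intg : lambda.-integrable setT (EFin \o g) by rewrite gE.
(* F (H x) = x - a, so F inverts H up to a translation. *)
pose F y := (\int[lambda]_(t in `]-oo, y]) g t)%R.
have FE x : a <= x <= b -> F (H x) = x - a.
  move=> /andP[ax xb].
  rewrite /F /Rintegral.
  rewrite (_ : (\int[lambda]_(t in `]-oo, H x]) (g t)%:E)%E =
      nu `]-oo, H x]%classic); last first.
    by rewrite nuE//; apply: eq_integral => t _; rewrite -gE.
  rewrite /nu (_ : _ `&` _ = `[a, x]%classic); last first.
    apply/seteqP; split=> z /=; rewrite !in_itv/= (expansive_le_mono H_expand).
      by move=> [-> /andP[->]].
    by move=> /andP[az zx]; split=> //; rewrite az (le_trans zx).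
  rewrite lebesgue_measure_itv/= lte_fin.
  have [<-|axn] := eqVneq a x; first by rewrite ltxx subrr.
  by rewrite lt_neqAle axn ax -EFinB.
(* Lebesgue differentiation recovers the density from its primitive. *)
have [M [mM M0 subM]] : {ae lambda, forall y, derivable F y 1 /\ derive1 F y = g y}.
  apply: FTC1Ny; last by apply: open_integrable_locally => //; exact: openT.
  by move=> y; exact: (integrableS measurableT).
have gk x : a < x < b -> ~ N x -> ~ M (H x) -> g (H x) <= k^-1.
  move=> /andP[ax xb] Nx MHx.
  have [dF F'] : derivable F (H x) 1 /\ derive1 F (H x) = g (H x).
    by apply: contrapT => /subM.
  have g0 : 0 <= g (H x) by rewrite -lee_fin; have := gam0 (H x); rewrite -gE.
  have [->|gn0] := eqVneq (g (H x)) 0; first by rewrite invr_ge0 ltW.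
  have dH : is_derive x 1 H (g (H x))^-1.
    have dF1 : is_derive (H x) 1 F (g (H x)).
      by apply: DeriveDef; [exact: dF|rewrite -derive1E].
    have /is_derive1_caratheodory[phi [phiE phic phig]] := dF1.
    (* Caratheodory slope of H at x: where F inverts H it is the inverse of the slope of F. Off []a,
       b[] the plain difference quotient is used; there z differs from x. *)
    pose psi z := if z \in `]a, b[ then (phi (H z))^-1
                  else (H z - H x) / (z - x).
    apply/is_derive1_caratheodory; exists psi; split.
    - move=> z; rewrite /psi; case: ifPn => [|zab].
        rewrite in_itv/= => /andP[az zb].
        have := phiE (H z).
        rewrite !FE ?ax ?xb ?(ltW ax) ?(ltW xb) ?(ltW az) ?(ltW zb)//.
        rewrite (_ : z - a - (x - a) = z - x); last by ring.
        move=> zx.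
        have [->|zxn] := eqVneq z x; first by rewrite !subrr mulr0.
        have pn0 : phi (H z) != 0.
          by apply: contra_neq zxn => p0; apply/eqP; rewrite -subr_eq0 zx p0 mul0r.
        by rewrite zx mulrA mulVf// mul1r.
      rewrite divfK// subr_eq0; apply: contraNneq zab => ->.
      by rewrite in_itv/= ax.
    - have /near_in_itvoo xab_near : x \in `]a, b[ by rewrite in_itv/= ax.
      apply: (@cvg_trans _ ((phi (H z))^-1 @[z --> x])).
        apply: near_eq_cvg; near=> z; rewrite /psi ifT//.
        by near: z; exact: xab_near.
      rewrite /psi in_itv/= ax xb/=; 
      apply: (@continuousV _ _ (phi \o H) x); first by rewrite /= phig.
      by apply: continuous_comp => //; exact: H_cont.
    - by rewrite /psi in_itv/= ax xb phig.
  have : k <= derive1 H x.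
    apply: contrapT => kH; apply: Nx; apply: subN => /= /(_ _ _)kH'.
    apply: kH; apply: kH'; [by rewrite ax xb|exact: ex_derive].
  have -> : derive1 H x = (g (H x))^-1.
    by rewrite derive1E; exact: (@derive_val _ _ _ _ _ _ _ dH).
  move=> kg.
  rewrite -[leLHS]invrK lef_pV2 ?posrE// invr_gt0 lt_def gn0//.
(* The points of ]a, b[ sent outside of S by H form a null set. *)
pose Y := [set` `[H a, H b]].
pose S := Y `&` g @^-1` `]-oo, k^-1].
have mg : measurable_fun setT g.
  by apply/measurable_EFinP; exact: measurable_int intg.
have mS : measurable S.
  apply: measurableI; first exact: measurable_itv.
  by rewrite -[X in measurable X]setTI; apply: mg => //; exact: measurable_itv.
have : ((b - a)%:E <= nu S)%E.
  have mHM := preimage_H_measurable mM; have mHS := preimage_H_measurable mS.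
  have mSab : measurable (H @^-1` S `&` `[a, b] : set (measurableTypeR R)).
    by apply: measurableI; [exact: mHS|exact: measurable_itv].
  have mNM : measurable (N `|` H @^-1` M : set (measurableTypeR R)).
    by apply: measurableU; [exact: mN|exact: mHM].
  have HM0 : lambda (H @^-1` M) = 0%E.
    by apply/eqP; rewrite -measure_le0 -M0; exact: expansive_preimage_le.
  have -> : (b - a)%:E = lambda `]a, b[%classic.
    by rewrite lebesgue_measure_itv/= lte_fin ab EFinB.
  apply: (@le_trans _ _ (lambda ((H @^-1` S `&` `[a, b]) `|` (N `|` H @^-1` M)))).
    apply: le_measure; rewrite ?inE.
    - exact: measurable_itv.
    - by apply: measurableU; [exact: mSab|exact: mNM].
    move=> x /=; rewrite in_itv/= => xab.
    have [Nx|Nx] := pselect (N x); first by right; left.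
    have [Mx|Mx] := pselect (M (H x)); first by right; right.
    have xab' : a <= x <= b by case/andP: xab => ax xb; rewrite !ltW.
    left; split; last by rewrite in_itv.
    split; last by rewrite /= in_itv/=; exact: gk.
    by rewrite /Y /= in_itv/= !(expansive_le_mono H_expand).
  apply: (le_trans (measureU2 lambda mSab mNM)).
  rewrite -[leRHS]adde0 leeD2l//.
  apply: (le_trans (measureU2 lambda mN mHM)).
  by rewrite [X in (X + _)%E]N0 [X in (_ + X)%E]HM0 adde0.
(* b - a <= nu S, which is the integral of g over S, and this is at most lambda Y / k. *)
move=> baS; rewrite -ler_pdivlMl// -lee_fin; apply: (le_trans baS).
rewrite nuE//; apply: (@le_trans _ _ (\int[lambda]_(x in S) (k^-1)%:E)%E).
  apply: ge0_le_integral => //.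
  - by apply: measurable_funS (measurable_int _ gamint).
  - by move=> x [_]; rewrite -gE/= in_itv/= lee_fin.
rewrite integral_cst// EFinM lee_pmul2l ?lte_fin ?invr_gt0//.
apply: (@le_trans _ _ (lambda Y)).
  by apply: le_measure; rewrite ?inE; [exact: mS|exact: measurable_itv|exact: subIsetl].
rewrite /Y lebesgue_measure_itv/= lte_fin (expansive_lt H_expand ab).
by rewrite EFinB.
Unshelve. all: by end_near. Qed.
End pushforward_expansive.

(** * Derivative bounds for nondecreasing functions *)

Section ae_derive.
Context {R : realType}.
Notation lambda := (@lebesgue_measure R).

(** Retraction of the line onto [[a, b]] when a <= b; composing with it extends a function on
    [[a, b]] by constants. *)
Definition clamp (a b x : R) : R := Num.max a (Num.min x b).

Lemma clamp_in a b x : a <= b -> a <= clamp a b x <= b.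
Proof. by move=> ab; rewrite /clamp le_max lexx ge_max ge_min lexx ab orbT. Qed.

Lemma clamp_id a b x : a <= x <= b -> clamp a b x = x.
Proof. by move=> /andP[ax xb]; rewrite /clamp min_l// max_r. Qed.

Lemma clamp_le a b x y : x <= y -> clamp a b x <= clamp a b y.
Proof. by move=> xy; rewrite /clamp; apply: le_max2 => //; exact: le_min2. Qed.

Lemma clamp_dist a b x y : `|clamp a b x - clamp a b y| <= `|x - y|.
Proof.
wlog xy : x y / x <= y.
  by move=> wl; have [/wl//|/ltW/wl] := leP x y; rewrite distrC [leRHS]distrC.
rewrite distrC [leRHS]distrC !ger0_norm ?subr_ge0//; last exact: clamp_le.
rewrite /clamp /Num.max /Num.min.
by case: (ltP x b) => ?; case: (ltP y b) => ?; repeat (case: ltP => ?); lra.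
Qed.

Lemma continuous_clamp a b (h : R -> R) : a <= b ->
  {within `[a, b], continuous h} -> continuous (h \o clamp a b).
Proof.
move=> ab /subspace_continuousP ch x.
have cab z : `[a, b]%classic (clamp a b z) by rewrite /= in_itv/= clamp_in.
have {}ch := ch _ (cab x).
apply/cvgrPdist_lt => e e0.
have /cvgrPdist_lt/(_ e e0)[d /= d0 hd] := ch.
exists d => //= z xz; apply: hd => //=.
- exact: le_lt_trans (clamp_dist _ _ _ _) xz.
- exact: cab.
Qed.

(** Adding the identity to h makes it expansive and raises the derivative by 1; the extra b - a
    cancels at the end. Only a lower bound can be expected, since h need not be absolutely
    continuous. *)
Lemma nondecreasing_ae_derive_ge (a b k : R) (h : R -> R) : a < b ->
  {within `[a, b], continuous h} ->
  {in `[a, b] &, {homo h : x y / x <= y}} -> 0 <= k ->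
  {ae lambda, forall x, a < x < b -> derivable h x 1 -> k <= derive1 h x} ->
  k * (b - a) <= h b - h a.
Proof.
move=> ab ch hh k0 kh.
pose H x := x + h (clamp a b x).
have H_expand x y : x <= y -> y - x <= H y - H x.
  move=> xy; rewrite /H.
  suff : h (clamp a b x) <= h (clamp a b y) by lra.
  by apply: hh; rewrite ?in_itv/= ?clamp_in ?(ltW ab)//; exact: clamp_le.
have H_cont : continuous H.
  by move=> x; apply: cvgD => //; exact: (continuous_clamp (ltW ab) ch).
have Hh x : a <= x <= b -> H x = x + h x by move=> xab; rewrite /H clamp_id.
have : (1 + k) * (b - a) <= H b - H a.
  apply: expansive_ae_derive_ge => //; first lra.
  apply: (@filterS _ _ (ae_filter_ringOfSetsType lambda) _ _ _ kh).
  move=> x {}kh /[dup] xab /andP[ax xb] dH.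
  (* On []a, b[] the clamp is the identity, so differentiability passes from H to h. *)
  have hE : {near x, H \- id =1 h}.
    have /near_in_itvoo xab_near : x \in `]a, b[ by rewrite in_itv/= ax.
    near=> z; rewrite /= Hh; first by rewrite addrC addKr.
    have : z \in `]a, b[ by near: z; exact: xab_near.
    by rewrite in_itv/= => /andP[az zb]; rewrite !ltW.
  have dHi : derivable (H \- id) x 1 by apply: derivableB => //; exact: derivable_id.
  have dh : derivable h x 1 := near_eq_derivable hE dHi.
  have := kh xab dh; rewrite !derive1E -(near_eq_derive (1 : R) hE) deriveB//.
  by rewrite derive_id; lra.
rewrite !Hh ?lexx ?(ltW ab)//; lra.
Unshelve. all: by end_near. Qed.

Lemma nondecreasing_derive1_ge0 (a b x : R) (h : R -> R) : a < x < b ->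
  {in `]a, b[ &, {homo h : x y / x <= y}} -> derivable h x 1 ->
  0 <= derive1 h x.
Proof.
move=> /andP[ax xb] hh dh; rewrite derive1E /derive.
apply: limr_ge => //.
near=> y.
have : `|y| < Num.min (x - a) (b - x).
  by near: y; apply: dnbhs0_lt; rewrite lt_min !subr_gt0 ax xb.
rewrite lt_min !ltr_norml => /andP[/andP[y1 y2] /andP[y3 y4]].
have yab : a < y *: 1 + x < b by rewrite scaler1; apply/andP; split; lra.
have xI : x \in `]a, b[ by rewrite in_itv/= ax.
have yI : y *: 1 + x \in `]a, b[ by rewrite in_itv.
have [y0|y0|->] := ltgtP y 0; last by rewrite invr0 scale0r.
- rewrite -[leRHS]/(_ * _) -mulrNN; apply: mulr_ge0; rewrite oppr_ge0.
    by rewrite invr_le0 ltW.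
  by rewrite subr_le0; apply: hh => //=; rewrite [_%:A]mulr1 gerDr ltW.
- rewrite -[leRHS]/(_ * _); apply: mulr_ge0; first by rewrite invr_ge0 ltW.
  by rewrite subr_ge0; apply: hh => //=; rewrite [_%:A]mulr1 lerDr ltW.
Unshelve. all: by end_near. Qed.

End ae_derive.

(** * Growth of [h] near [a] *)

Section growth.
Context {R : realType} (a b d t : R) (h : R -> R).
Notation lambda := (@lebesgue_measure R).
Hypothesis adb : a < d < b.
Hypothesis h_cont : {within `[a, b[, continuous h}.
Hypothesis h_homo : {in `[a, b[ &, {homo h : x y / x <= y}}.
Hypothesis h_gt : forall x, a < x < b -> h a < h x.
Hypothesis h_ess : {ae lambda, forall x, a <= x <= d ->
  derivable h x 1 -> (ess_quot a h x <= t%:E)%E}.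

(** At almost every point of differentiability in []s, u[] both h' >= 0 and the essential bound are
    available, so the bound k only has to be derived from these two. *)
Let derive_ge_const s u k : a < s -> s < u -> u <= d -> 0 <= k ->
  (forall x, s < x < u -> 0 <= derive1 h x -> (ess_quot a h x <= t%:E)%E ->
    k <= derive1 h x) ->
  k * (u - s) <= h u - h s.
Proof.
move=> as_ su ud k0 kP; case/andP: adb => ad db.
have sub : {subset `[s, u] <= `[a, b[}.
  by move=> x; rewrite !in_itv/= => /andP[sx xu]; apply/andP; split; lra.
apply: nondecreasing_ae_derive_ge => //.
- by apply: continuous_subspaceW h_cont => x; exact: sub.
- by move=> x y xI yI; apply: h_homo; exact: sub.
- apply: (@filterS _ _ (ae_filter_ringOfSetsType lambda) _ _ _ h_ess).
  move=> x hx /[dup] xsu /andP[sx xu] dh; apply: kP => //; last first.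
    by apply: hx => //; apply/andP; split; lra.
  apply: (@nondecreasing_derive1_ge0 _ s u) => //.
  by move=> y z yI zI; apply: h_homo; apply: sub; apply: subset_itv_oo_cc.
Qed.

(* For t < 0 the hypothesis h_ess says that h is differentiable almost nowhere,
   and then derive_ge_const holds for arbitrarily large k. *)
Lemma ess_bound_ge0 : 0 <= t.
Proof.
rewrite leNgt; apply/negP => t0; case/andP: adb => ad db.
pose s := (a + d) / 2.
have key k : 0 <= k ->
    k * (d - s) <= h d - h s.
  move=> k0; apply: derive_ge_const => //; rewrite /s; [lra|lra|].
  move=> x /andP[sx xd] hx0; rewrite /ess_quot; case: ifPn => // hxn0.
  rewrite lee_fin leNgt => /negP[]; apply: (lt_le_trans t0).
  rewrite divr_ge0// ?mulr_ge0// subr_ge0; last lra.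
  by apply/ltW/h_gt/andP; split; lra.
have hds : h s <= h d.
  by apply: h_homo; rewrite ?in_itv/= /s; [apply/andP; split; lra..|lra].
have ds : 0 < d - s by rewrite /s; lra.
(* With k the slope of h over [[s, d]] plus 1, [key] is false. *)
have k0 : 0 <= (h d - h s) / (d - s) + 1.
  by rewrite addr_ge0// divr_ge0 ?subr_ge0// ltW// -subr_gt0.
by have := key _ k0; rewrite mulrDl divfK ?gt_eqF// mul1r; lra.
Qed.

(** For s < x < u the essential bound gives h'(x) >= (h x - h a) / (t' (x - a)), which is at least
    the constant (h s - h a) / (t' (u - a)). Zeros of h' are excluded because [ess_quot] is +oo
    there. A positive t' allows division even when t = 0. *)
Lemma increment_ge t' s u : t <= t' -> 0 < t' -> a < s -> s <= u -> u <= d ->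
  (h s - h a) * (u - s) <= t' * (u - a) * (h u - h s).
Proof.
move=> tt' t'0 as_; rewrite le_eqVlt => /predU1P[->|su] ud.
  by rewrite !subrr !mulr0.
case/andP: adb => ad db.
have ua : 0 < u - a by lra.
have hs : 0 < h s - h a by rewrite subr_gt0; apply/h_gt/andP; split; lra.
have c0 : 0 < t' * (u - a) by rewrite mulr_gt0.
rewrite -ler_pdivrMl// mulrC mulrAC.
apply: derive_ge_const => //; first by rewrite divr_ge0// ltW.
move=> x /andP[sx xu] h'0; rewrite /ess_quot; case: ifPn => // h'n0.
have {h'n0}h'0 : 0 < derive1 h x by rewrite lt_def h'n0.
have xa : 0 < x - a by lra.
rewrite lee_fin ler_pdivrMr ?mulr_gt0// => hx.
rewrite ler_pdivrMr//.
have hsx : h s <= h x.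
  by apply: h_homo; rewrite ?in_itv/=; [apply/andP; split; lra..|lra].
apply: (@le_trans _ _ (h x - h a)); first lra.
apply: (le_trans hx); rewrite [leRHS]mulrC -mulrA.
apply: ler_pM => //; last by rewrite ler_wpM2r//; lra.
- exact: ess_bound_ge0.
- by rewrite mulr_ge0// ltW.
Qed.

(** Passing from u to v = a + p (u - a), [increment_ge] with u - v = (1 - p) (u - a) divides h - h a
    by at least 1 + (1 - p) / t'; this is iterated n times. *)
Lemma geometric_growth t' p n x : t <= t' -> 0 < t' -> 0 < p -> p <= 1 ->
  a < x <= d ->
  (h (a + p ^+ n * (x - a)) - h a) * (1 + (1 - p) / t') ^+ n <= h x - h a.
Proof.
move=> tt' t'0 p0 p1 /andP[ax xd]; elim: n => [|n IHn].
  by rewrite expr0 mul1r mulr1 (addrC a) subrK.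
apply: le_trans IHn.
set u := a + p ^+ n * (x - a).
have -> : a + p ^+ n.+1 * (x - a) = a + p * (u - a) by rewrite /u exprS; ring.
have pn0 : 0 < p ^+ n by rewrite exprn_gt0.
have pn1 : p ^+ n <= 1 by rewrite exprn_ile1// ltW.
have au : a < u by rewrite /u ltrDl mulr_gt0// subr_gt0.
have ud : u <= d.
  apply: le_trans xd; rewrite /u -lerBrDl ler_piMl// subr_ge0 ltW//.
rewrite exprS mulrA ler_wpM2r//.
  by rewrite exprn_ge0// addr_ge0// divr_ge0 ?subr_ge0// ltW.
have pu : 0 < p * (u - a) by rewrite mulr_gt0// subr_gt0.
have := @increment_ge t' (a + p * (u - a)) u tt' t'0.
rewrite ltrDl pu => /(_ isT).
have puu : p * (u - a) <= u - a by rewrite ler_piMl// subr_ge0 ltW.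
have -> : a + p * (u - a) <= u by lra.
move=> /(_ isT ud).
set v := a + p * (u - a).
have -> : (h v - h a) * (u - v) = (h v - h a) * (1 - p) * (u - a).
  by rewrite /v; ring.
rewrite [leRHS]mulrAC ler_pM2r ?subr_gt0// -ler_pdivrMl// => H.
rewrite mulrDr mulr1 mulrA [_ / t']mulrC; lra.
Qed.

(** Take p = q ^ (1 / n) in [geometric_growth]: n steps shrink the distance to a by exactly q, and
    since t < - ln q the accumulated factor exceeds e once n is large. *)
Lemma exponential_growth q : 0 < q -> t < - ln q ->
  exists2 r, 1 < r & forall x, a < x <= d ->
    (h (a + q * (x - a)) - h a) * expR r < h x - h a.
Proof.
set A := - ln q => q0 tA.
have t0 := ess_bound_ge0.
(* (1 + (1 - q ^ (1/n)) / t') ^ n tends to e ^ (A / t') > e. *)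
pose t' := (t + A) / 2.
have tt' : t <= t' by rewrite /t'; lra.
have t'0 : 0 < t' by rewrite /t'; lra.
have t'A : t' < A by rewrite /t'; lra.
(* r lies strictly between 1 and A / t'. The exponent returned is (1 + r) / 2, above 1 and below r,
   which makes the final inequality strict. *)
pose r := 2 * A / (t' + A).
have r1 : 1 < r by rewrite /r ltr_pdivlMr; lra.
exists ((1 + r) / 2); first lra.
(* n is so large that z (t' + 1) < (A - t') / 2 for z = A / (n + 1). *)
have [n nA] : exists n : nat, A * (t' + 1) / ((A - t') / 2) < n.+1%:R.
  have At : 0 <= A * (t' + 1) / ((A - t') / 2).
    by rewrite divr_ge0 ?mulr_ge0//; lra.
  by eexists; apply: lt_trans (archi_boundP At) _; rewrite ltr_nat.
pose z := A / n.+1%:R; pose p := expR (- z); pose y := (1 - p) / t'.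
have n0 : 0 < n.+1%:R :> R by rewrite ltr0n.
have z0 : 0 < z by rewrite divr_gt0// (lt_trans t'0).
have zA : z * (t' + 1) < (A - t') / 2.
  move: nA; rewrite ltr_pdivrMr; last lra.
  by rewrite -ltr_pdivrMl// mulrA [_^-1 * _]mulrC.
have p1 : p <= 1 by rewrite -expR0 ler_expR; lra.
have pn : p ^+ n.+1 = q.
  rewrite /p -expRM_natl /z mulrN mulrCA mulfV ?gt_eqF// mulr1 /A opprK lnK//.
have y0 : 0 <= y by rewrite divr_ge0 ?subr_ge0// ltW.
have pz : p * (1 + z) <= 1.
  by rewrite /p expRN ler_pdivrMl ?expR_gt0// mulr1 expR_ge1Dx.
have zy : z <= y * t' * (1 + z).
  by rewrite /y divfK ?gt_eqF//; lra.
(* As e ^ (y / (1 + y)) <= 1 + y, the bound r <= (n + 1) y / (1 + y) suffices. It comes from [zy]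
   and [zA], with (n + 1) z = A. *)
have ry : r <= n.+1%:R * (y / (1 + y)).
  have nz : n.+1%:R * z = A by rewrite /z mulrCA mulfV ?gt_eqF// mulr1.
  rewrite /r ler_pdivrMr; last lra.
  rewrite mulrA mulrAC ler_pdivlMr; last lra.
  have yz : y * (z * (t' + 1)) <= y * ((A - t') / 2) by rewrite ler_wpM2l// ltW.
  have : 2 * z * (1 + y) <= y * (t' + A) by lra.
  move=> /(ler_wpM2l (ltW n0)).
  have : n.+1%:R * z * y = A * y by rewrite nz.
  lra.
have exp_le : expR r <= (1 + y) ^+ n.+1.
  apply: (@le_trans _ _ (expR (n.+1%:R * (y / (1 + y))))); first by rewrite ler_expR.
  rewrite expRM_natl lerXn2r ?nnegrE ?expR_ge0//; first lra.
  have y1 : 0 < 1 + y by lra.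
  have : (1 + y)^-1 <= expR (- (y / (1 + y))).
    have {1}-> : (1 + y)^-1 = 1 + - (y / (1 + y)) by field; rewrite gt_eqF.
    exact: expR_ge1Dx.
  by rewrite expRN lef_pV2// posrE expR_gt0.
move=> x axd.
have /andP[ax xd] := axd.
have := @geometric_growth t' p n.+1 x tt' t'0 (expR_gt0 _) p1 axd.
rewrite pn -/y; apply: lt_le_trans.
have hq : 0 < h (a + q * (x - a)) - h a.
  have q1 : q <= 1 by rewrite -pn exprn_ile1// expR_ge0.
  have qx0 : 0 < q * (x - a) by rewrite mulr_gt0// subr_gt0.
  have qx : q * (x - a) <= x - a by rewrite ler_piMl// subr_ge0 ltW.
  by rewrite subr_gt0; case/andP: adb => ad db; apply/h_gt/andP; split; lra.
rewrite ltr_pM2l//; apply: lt_le_trans exp_le; rewrite ltr_expR; lra.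
Qed.

End growth.

(** * Advanced inequalities *)

Section advanced.
Context {R : realType}.

(** Discrete form of f'(v) >= f(v + r) - f(v), for u decreasing to 0. Summing over all k gives c (u
    0 + ... + u (m - 1)) <= u m, whereas monotonicity makes the left side at least c m u m > u m. *)
Lemma advanced_sequence_absurd (u : nat -> R) (c : R) (m : nat) :
  1 < c * m%:R -> 0 <= c ->
  (forall k, 0 < u k) -> (forall k, u k.+1 <= u k) ->
  (forall e, 0 < e -> exists k, u k < e) ->
  (forall k, c * (u k - u (k + m)%N) <= u (k + m)%N - u (k + m).+1) -> False.
Proof.
move=> cm c0 u0 u_dec u_small u_adv.
have u_le k j : (k <= j)%N -> u j <= u k.
  by move/subnK <-; elim: (j - k)%N => // n; apply: le_trans; rewrite addSn u_dec.
(* Telescoping: P is nondecreasing, although P 0 > 0 and P k --> 0. *)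
pose P k := c * \sum_(j < m) u (k + j)%N - u (k + m)%N.
have P_incr k : P k <= P k.+1.
  have : u k + \sum_(j < m) u (k.+1 + j)%N = \sum_(j < m) u (k + j)%N + u (k + m)%N.
    transitivity (\sum_(j < m.+1) u (k + j)%N); last by rewrite big_ord_recr.
    rewrite big_ord_recl/= addn0; congr (_ + _).
    by apply: eq_bigr => j _; rewrite /bump/= addSnnS.
  move=> /(congr1 ( *%R c)); have := u_adv k.
  by rewrite /P !mulrDr addSn; lra.
have P0 k : P 0%N <= P k by elim: k => // k /le_trans; apply.
have sum_ge : m%:R * u m <= \sum_(j < m) u (0 + j)%N.
  apply: (@le_trans _ _ (\sum_(j < m) u m)).
    by rewrite sumr_const card_ord mulr_natl.
  by apply: ler_sum => j _; apply: u_le; rewrite add0n ltnW.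
have P00 : 0 < P 0%N.
  rewrite /P add0n; apply: (@lt_le_trans _ _ (c * (m%:R * u m) - u m)).
    by rewrite mulrA -{2}[u m]mul1r -mulrBl mulr_gt0// subr_gt0.
  by rewrite lerB// ler_wpM2l.
have [k uk] := u_small (P 0%N / (c * m%:R)) (divr_gt0 P00 (lt_trans ltr01 cm)).
have sum_le : \sum_(j < m) u (k + j)%N <= m%:R * u k.
  apply: (@le_trans _ _ (\sum_(j < m) u k)); last first.
    by rewrite sumr_const card_ord mulr_natl.
  by apply: ler_sum => j _; apply: u_le; rewrite leq_addr.
have : P k < P 0%N.
  apply: (@le_lt_trans _ _ (c * m%:R * u k)).
    rewrite /P -mulrA lerBlDr -[leLHS]addr0 lerD// ?ler_wpM2l// ltW//.
  by rewrite mulrC -ltr_pdivlMr// (lt_trans ltr01).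
by rewrite ltNge P0.
Qed.

(** Choose points T k along which h decreases by the factor [sg], where sg ^ (m + 1) = e ^ r. Then T
    (k + m + 1) lies above a + q (T k - a), and [f_adv] at T k becomes the inequality of
    [advanced_sequence_absurd] for f (T k) - L with c = sg - 1. *)
Lemma advanced_function_absurd (a d q r L : R) (h f : R -> R) :
  a < d -> 1 < r -> 0 < q <= 1 ->
  {within `[a, d], continuous h} -> {in `[a, d] &, {homo h : x y / x <= y}} ->
  h a = 0 -> (forall x, a < x <= d -> 0 < h x) ->
  (forall x, a < x <= d -> h (a + q * (x - a)) * expR r < h x) ->
  {in `]a, d] &, {homo f : x y / x <= y}} ->
  (forall x, a < x <= d -> L < f x) -> f @ a^'+ --> L ->
  (forall x s t, a < x <= d -> a + q * (x - a) < s -> s < t -> t <= x ->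
    (f x - f t) * (h t - h s) <= h s * (f t - f s)) ->
  False.
Proof.
move=> ad r1 /andP[q0 q1] h_cont h_homo ha h_gt h_exp f_homo fL f_cvg f_adv.
have hd : 0 < h d by apply: h_gt; rewrite ad lexx.
(* m (r - 1) > 1 means r m / (m + 1) > 1: of m + 1 geometric steps only m serve as delay, the last
   one being the increment from s to t. *)
have [m mr] : exists m : nat, (r - 1)^-1 < m%:R.
  by eexists; apply: archi_boundP; rewrite invr_ge0 subr_ge0 ltW.
have m1 : 0 < m.+1%:R :> R by rewrite ltr0n.
pose sg := expR (r / m.+1%:R).
have sg0 : 0 < sg by exact: expR_gt0.
have sg_ge : 1 + r / m.+1%:R <= sg by exact: expR_ge1Dx.
have rm0 : 0 < r / m.+1%:R by rewrite divr_gt0//; lra.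
have sg1 : 1 < sg by apply: lt_le_trans sg_ge; rewrite ltrDl.
have sgm : sg ^+ m.+1 = expR r.
  by rewrite /sg -expRM_natl mulrCA mulfV ?gt_eqF// mulr1.
have cm : 1 < (sg - 1) * m%:R.
  apply: (@lt_le_trans _ _ (r / m.+1%:R * m%:R)); last first.
    by rewrite ler_wpM2r// lerBrDl.
  rewrite mulrAC ltr_pdivlMr// mul1r -natr1.
  have : 1 < m%:R * (r - 1) by rewrite -ltr_pdivrMr ?div1r ?subr_gt0.
  lra.
have ex_t k : exists t, a <= t <= d /\ h t = h d * sg ^- k.
  have v0 : 0 < h d * sg ^- k by rewrite divr_gt0// exprn_gt0.
  have v1 : h d * sg ^- k <= h d.
    by rewrite ler_pdivrMr ?exprn_gt0// ler_peMr ?(ltW hd)// exprn_ege1// ltW.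
  have [|t] := @IVT R h a d (h d * sg ^- k) (ltW ad) h_cont.
    by rewrite ha ge_min le_max (ltW v0) v1 orbT.
  by rewrite in_itv/= => tad <-; exists t.
have /choice[T TP] := ex_t.
have hT k : h (T k) = h d * sg ^- k by have [] := TP k.
have Tgt k : a < T k <= d.
  have [/andP[aT ->] _] := TP k; rewrite andbT lt_neqAle aT andbT.
  apply/eqP => aE; have := hT k; rewrite -aE ha; apply/eqP.
  by rewrite lt_eqF// divr_gt0// exprn_gt0.
have Tcc k : T k \in `[a, d].
  by rewrite in_itv/=; have /andP[/ltW-> ->] := Tgt k.
have Toc k : T k \in `]a, d] by rewrite in_itv/=.
have h_lt x y : x \in `[a, d] -> y \in `[a, d] -> h x < h y -> x < y.
  by move=> xI yI; apply: contraTT; rewrite -!leNgt => /h_homo; apply.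
have hTS k : h (T k) = sg * h (T k.+1).
  by rewrite !hT exprS invfM mulrCA mulVKf// gt_eqF.
have hTm k n : h (T k) = sg ^+ n * h (T (k + n)%N).
  elim: n => [|n IHn]; first by rewrite mul1r addn0.
  by rewrite IHn hTS addnS exprSr mulrA.
have T_lt k : T k.+1 < T k.
  by apply: h_lt => //; rewrite (hTS k) ltr_pMl// h_gt.
have T_le k j : (k <= j)%N -> T j <= T k.
  by move/subnK <-; elim: (j - k)%N => // n; apply: le_trans; rewrite addSn ltW.
apply: (@advanced_sequence_absurd (fun k => f (T k) - L) (sg - 1) m) => //.
- lra.
- by move=> k; rewrite subr_gt0 fL.
- by move=> k; rewrite lerB// f_homo// ltW.
- move=> e e0.
  (* Some T k lies to the left of a point z with f z < L + e, because sg ^ k is unbounded by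
     Bernoulli's inequality. *)
  have [z [az zd fz]] : exists z, [/\ a < z, z < d & f z < L + e].
    near a^'+ => z; exists z; split; near: z.
    - exact: nbhs_right_gt.
    - exact: nbhs_right_lt.
    - by apply: (cvgr_lt _ f_cvg); rewrite ltrDl.
  have hz : 0 < h z by apply: h_gt; rewrite az ltW.
  have [k hk] : exists k, h d * sg ^- k < h z.
    have sg0' : 0 < sg - 1 by lra.
    have [k kb] : exists k : nat, h d / h z / (sg - 1) < k%:R.
      eexists; apply: archi_boundP; rewrite !divr_ge0 ?ltW//.
    exists k; rewrite ltr_pdivrMr ?exprn_gt0// -ltr_pdivrMl// mulrC.
    apply: (lt_le_trans (y := k%:R * (sg - 1))); first by rewrite -ltr_pdivrMr.
    have : 1 + (sg - 1) * k%:R <= sg ^+ k.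
      elim: k {kb} => [|k IHk]; first by rewrite mulr0 addr0.
      have := ler_wpM2l (ltW sg0) IHk; rewrite -exprS -natr1.
      have : 0 <= (sg - 1) * (sg - 1) * k%:R by rewrite !mulr_ge0// ltW.
      lra.
    lra.
  exists k; rewrite ltrBlDl; apply: le_lt_trans fz; apply: f_homo => //.
    by rewrite in_itv/= az ltW.
  by apply/ltW/h_lt => //; [rewrite in_itv/= !ltW|rewrite hT].
- move=> k.
  have hs0 : 0 < h (T (k + m).+1) by exact: h_gt.
  have := @f_adv (T k) (T (k + m).+1) (T (k + m)%N) (Tgt k).
  (* h at a + q (T k - a) is below e ^ (- r) h (T k) = h (T (k + m + 1)), and monotonicity of h
     orders the points. *)
  have -> : a + q * (T k - a) < T (k + m).+1.
    have /andP[aT Td] := Tgt k.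
    have qT0 : 0 < q * (T k - a) by rewrite mulr_gt0// subr_gt0.
    have qT : q * (T k - a) <= T k - a by rewrite ler_piMl// subr_ge0 ltW.
    apply: h_lt => //; first by rewrite in_itv/=; apply/andP; split; lra.
    rewrite -(ltr_pM2r (expR_gt0 r)); apply: lt_le_trans (h_exp _ (Tgt k)) _.
    by rewrite (hTm k m.+1) sgm addnS mulrC.
  rewrite T_lt T_le ?leq_addr// => /(_ isT isT isT).
  rewrite (hTS (k + m)%N).
  rewrite (_ : sg * _ - _ = h (T (k + m).+1) * (sg - 1)); last by ring.
  rewrite mulrCA ler_pM2l//; lra.
Unshelve. all: by end_near. Qed.

End advanced.

(** * Local extrema of F_x *)

Section local_extrema.
Context {R : realType}.
Implicit Types (D : set R) (F : R -> R).

(** Replacing h and g by h - h a and g - g a changes F_x by a constant only. *)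
Lemma is_local_extremum_shift D F G c t : (forall s, G s = F s + c) ->
  is_local_extremum D F t -> is_local_extremum D G t.
Proof.
by move=> GF [[e e0 H]|[e e0 H]]; [left|right]; exists e => // s Ds se;
  rewrite !GF lerD2r H.
Qed.

Lemma is_local_extremumN D F t :
  is_local_extremum D (\- F) t -> is_local_extremum D F t.
Proof.
by move=> [[e e0 H]|[e e0 H]]; [right|left]; exists e => // s Ds se;
  rewrite -lerN2; exact: H.
Qed.

(** Rolle's theorem without derivatives: a maximum or minimum point inside []s, t[] works; if both
    sit at the ends, F is constant and the midpoint does. Within [rad c] of c one stays in
    [[s, t]]. *)
Lemma eq_ends_local_extremum D F s t : s < t -> {within `[s, t], continuous F} ->
  F s = F t -> exists2 c, s < c < t & is_local_extremum D F c.
Proof.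
move=> st Fc Fst.
pose rad c := Num.min (c - s) (t - c).
have rad_gt0 c : s < c < t -> 0 < rad c.
  by move=> /andP[? ?]; rewrite /rad lt_min !subr_gt0; apply/andP.
have rad_in c x : `|x - c| < rad c -> x \in `[s, t].
  rewrite /rad lt_min !ltr_norml in_itv/= => /andP[/andP[? ?] /andP[? ?]].
  by apply/andP; split; lra.
have [c cst cmax] := EVT_max (ltW st) Fc.
have [d dst dmin] := EVT_min (ltW st) Fc.
have [cI|cE] := boolP (s < c < t).
  exists c => //; left; exists (rad c); first exact: rad_gt0.
  by move=> x _ /rad_in; exact: cmax.
have [dI|dE] := boolP (s < d < t).
  exists d => //; right; exists (rad d); first exact: rad_gt0.
  by move=> x _ /rad_in; exact: dmin.
have ends x : x \in `[s, t] -> ~~ (s < x < t) -> F x = F s.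
  rewrite in_itv/= negb_and -!leNgt => /andP[sx xt] /orP[xs|tx].
    by congr F; apply/eqP; rewrite eq_le xs.
  by rewrite Fst; congr F; apply/eqP; rewrite eq_le xt.
have mI : s < (s + t) / 2 < t by apply/andP; split; lra.
exists ((s + t) / 2) => //; left; exists (rad ((s + t) / 2)).
  exact: rad_gt0.
move=> x _ /rad_in /cmax; rewrite (ends _ cst cE) -(ends _ dst dE) => /le_trans.
by apply; apply: dmin; rewrite in_itv/=; case/andP: mI => /ltW-> /ltW->.
Qed.

End local_extrema.

(** * Intervals without local extrema *)

Section no_extremum.
Context {R : realType} (a b d q r : R) (h : R -> R).
Hypothesis adb : a < d < b.
Hypothesis q01 : 0 < q < 1.
Hypothesis r1 : 1 < r.
Hypothesis h_cont : {within `[a, b[, continuous h}.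
Hypothesis h_homo : {in `[a, b[ &, {homo h : x y / x <= y}}.
Hypothesis ha : h a = 0.
Hypothesis h_gt : forall x, a < x < b -> 0 < h x.
Hypothesis h_exp : forall x, a < x <= d -> h (a + q * (x - a)) * expR r < h x.

Section fixed_g.
Context (g : R -> R) (L : R).
Hypothesis g_cont : {within `[a, b[, continuous g}.
Hypothesis f_cvg : (fun x => g x / h x) @ a^'+ --> L.

Let f x := g x / h x.
Let F x t := g x * h t - h x * g t.

Hypothesis F_no_extremum : forall x t, a < x <= d -> a + q * (x - a) < t < x ->
  ~ is_local_extremum `[a, b[%classic (F x) t.

Let gE x : a < x < b -> g x = f x * h x.
Proof. by move=> xab; rewrite /f divfK// gt_eqF// h_gt. Qed.

Let FE x t : a < x < b -> a < t < b -> F x t = h x * h t * (f x - f t).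
Proof. by move=> xab tab; rewrite /F (gE xab) (gE tab); ring. Qed.

Let q_gt x : a < x -> a < a + q * (x - a).
Proof. by move=> ax; case/andP: q01 => q0 _; rewrite ltrDl mulr_gt0// subr_gt0. Qed.

Let F_cont x (A : set R) : A `<=` `[a, b[ -> {within A, continuous (F x)}.
Proof.
move=> Aab.
have /subspace_continuousP hc := continuous_subspaceW Aab h_cont.
have /subspace_continuousP gc := continuous_subspaceW Aab g_cont.
apply/subspace_continuousP => t At; rewrite /F.
apply: cvgB.
  by apply: cvgM; [exact: cvg_cst|exact: hc].
by apply: cvgM; [exact: cvg_cst|exact: gc].
Qed.

Let f_cont (A : set R) : A `<=` `]a, b[ -> {within A, continuous f}.
Proof.
move=> Aab.
have Aab' : A `<=` `[a, b[ by move=> x /Aab/=; exact: subset_itv_oo_co.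
have /subspace_continuousP hc := continuous_subspaceW Aab' h_cont.
have /subspace_continuousP gc := continuous_subspaceW Aab' g_cont.
apply/subspace_continuousP => t At; rewrite /f.
apply: cvgM; first exact: gc.
apply: cvgV; last exact: hc.
by rewrite gt_eqF// h_gt//; have := Aab _ At; rewrite /= in_itv.
Qed.

Let F_neq x s t : a < x <= d -> a + q * (x - a) < s -> s < t -> t <= x ->
  F x s != F x t.
Proof.
move=> axd qs st tx; have /andP[ax xd] := axd; case/andP: adb => ad db.
have qa := q_gt ax.
apply/eqP => Fst.
have [|c /andP[sc ct]] := @eq_ends_local_extremum _ `[a, b[ _ _ _ st _ Fst.
  apply: F_cont => z /=; rewrite !in_itv/= => /andP[sz zt].
  by apply/andP; split; lra.
by apply: F_no_extremum => //; apply/andP; split; lra.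
Qed.

(** F_t vanishes at t, so F_t s != F_t t yields f s != f t. As t <= x, the interval free of extrema
    for t starts no later than the one for x. *)
Let f_neq x s t : a < x <= d -> a + q * (x - a) < s -> s < t -> t <= x ->
  f s != f t.
Proof.
move=> /andP[ax xd] qs st tx; have qa := q_gt ax; case/andP: adb => ad db.
have sab : a < s < b by apply/andP; split; lra.
have tab : a < t < b by apply/andP; split; lra.
have : F t s != F t t.
  apply: (@F_neq t) => //; first by apply/andP; split; lra.
  apply: le_lt_trans qs; rewrite lerD2l ler_pM2l; last by case/andP: q01.
  by rewrite lerD2r.
rewrite !FE// subrr mulr0; apply: contraNneq => ->.
by rewrite subrr mulr0.
Qed.

(** [f_neq] gives injectivity on short intervals only. If f s = f t, then f has a local extremum c
    in between; but around c it is continuous and injective, hence strictly monotone, a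
    contradiction. *)
Lemma quotient_strict_monotonic : strict_monotonic `]a, d] (fun x => g x / h x).
Proof.
case/andP: adb => ad db; case/andP: q01 => q0 q1.
have sub : `]a, d] `<=` `]a, b[.
  by move=> x /=; rewrite !in_itv/= => /andP[-> xd]; exact: le_lt_trans db.
apply: (@itv_continuous_inj_mono _ f); first exact: f_cont.
suff f_inj s t : a < s -> s < t -> t <= d -> f s != f t.
  move=> s t; rewrite !in_itv/= => /andP[as_ sd] /andP[at_ td] fst.
  apply/eqP; apply: contraPT fst => st; apply/eqP.
  have [/f_inj|/f_inj|E] := ltgtP s t; [exact| |by rewrite E eqxx in st].
  by rewrite eq_sym; exact.
move=> as_ st td; apply/eqP => fst.
have stsub (u v : R) : a < u -> v <= d -> `[u, v]%classic `<=` `]a, b[.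
  move=> au vd x /=; rewrite !in_itv/= => /andP[ux xv].
  by apply/andP; split; lra.
have [c /andP[sc ct] c_ext] := @eq_ends_local_extremum _ `]a, b[ _ _ _ st
  (f_cont (stsub _ _ as_ td)) fst.
(* At a local extremum f cannot cross the value f c. *)
have [e e0 ce] : exists2 e, 0 < e & forall u v, a < u < b -> a < v < b ->
    `|u - c| < e -> `|v - c| < e -> u < c -> c < v ->
    ~ (f u < f c < f v) /\ ~ (f v < f c < f u).
  case: c_ext => -[e e0 ce]; exists e => // u v uab vab ue ve uc cv.
    by split=> /andP[]; rewrite !ltNge !ce ?in_itv.
  by split=> /andP[]; rewrite !ltNge !ce ?in_itv.
have qc0 : 0 < (1 - q) * (c - a) by rewrite mulr_gt0//; lra.
have qc1 : 0 < q * (c - a) by rewrite mulr_gt0//; lra.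
(* The three terms keep c - w and c + w within e of c, keep c + w <= t <= d, and put c - w above a +
   q (c + w - a). *)
pose w := Num.min (e / 2) (Num.min (t - c) ((1 - q) * (c - a) / 4)).
have w0 : 0 < w by rewrite /w !lt_min; apply/and3P; split; lra.
have : w <= w by [].
rewrite {2}/w !le_min => /and3P[we wt wq].
have cwd : a < c + w <= d by apply/andP; split; lra.
have qcw : a + q * (c + w - a) < c - w.
  have : q * w < w by rewrite gtr_pMl.
  lra.
have [H1 H2] : ~ (f (c - w) < f c < f (c + w)) /\ ~ (f (c + w) < f c < f (c - w)).
  apply: ce; try (by apply/andP; split; lra); try lra.
    by rewrite ltr_norml; apply/andP; split; lra.
  by rewrite ltr_norml; apply/andP; split; lra.
have : strict_monotonic `[c - w, c + w] f.
  apply: itv_continuous_inj_mono.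
    by apply: f_cont; apply: stsub; lra.
  move=> u v; rewrite !in_itv/= => /andP[cu uc] /andP[cv vc] fuv.
  apply/eqP; apply: contraPT fuv => uv; apply/eqP.
  have [uv'|uv'|E] := ltgtP u v; last by rewrite E eqxx in uv.
    by apply: (@f_neq (c + w)) => //; lra.
  by rewrite eq_sym; apply: (@f_neq (c + w)) => //; lra.
by case=> mono; [apply: H1|apply: H2]; rewrite !mono// ?in_itv/=; lra.
Qed.

(** F_x x = 0 < F_x s forces F_x to decrease on its interval free of extrema; dividing F_x t < F_x s
    by h x gives the advanced inequality. *)
Lemma quotient_increasing_absurd :
  {in `]a, d] &, {homo (fun x => g x / h x) : x y / x < y}} -> False.
Proof.
move=> f_incr; case/andP: adb => ad db; case/andP: q01 => q0 q1.
have f_homo : {in `]a, d] &, {homo f : x y / x <= y}}.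
  by move=> x y xI yI; rewrite le_eqVlt => /predU1P[->//|/f_incr xy]; exact/ltW/xy.
have dab x : a < x <= d -> a < x < b by move=> /andP[ax xd]; apply/andP; split; lra.
have sub : `[a, d]%classic `<=` `[a, b[.
  by move=> x /=; rewrite !in_itv/= => /andP[? ?]; apply/andP; split; lra.
apply: (@advanced_function_absurd R a d q r L h f) => //.
- by rewrite q0 ltW.
- exact: continuous_subspaceW h_cont.
- by move=> x y xI yI; apply: h_homo; exact: sub.
- by move=> x /dab; exact: h_gt.
(* The midpoint makes the bound strict: L <= f s < f x. *)
- move=> x /andP[ax xd]; pose s := (a + x) / 2.
  have [as_ sx] : a < s /\ s < x by rewrite /s; split; lra.
  have sI : s \in `]a, d] by rewrite in_itv/=; apply/andP; split; lra.
  apply: (@le_lt_trans _ _ (f s)); last first.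
    by apply: f_incr => //; rewrite in_itv/= ax.
  apply: (cvgr_to_le f_cvg); near=> z; apply: f_homo => //.
    rewrite in_itv/=; apply/andP; split; near: z; first exact: nbhs_right_gt.
    by apply: nbhs_right_le; lra.
  by near: z; exact: nbhs_right_le.
- move=> x s t /[dup] axd /andP[ax xd] qs st tx.
  have qa := q_gt ax.
  have xab := dab _ axd.
  have sab : a < s < b by apply/andP; split; lra.
  have tab : a < t < b by apply/andP; split; lra.
  have Fmono : strict_monotonic `]a + q * (x - a), x] (F x).
    apply: itv_continuous_inj_mono.
      apply: F_cont => z /=; rewrite !in_itv/= => /andP[? ?].
      by apply/andP; split; lra.
    move=> u v; rewrite !in_itv/= => /andP[cu uc] /andP[cv vc] fuv.
    apply/eqP; apply: contraPT fuv => uv; apply/eqP.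
    have [uv'|uv'|E] := ltgtP u v; last by rewrite E eqxx in uv.
      exact: F_neq.
    by rewrite eq_sym; exact: F_neq.
  have sI : s \in `]a + q * (x - a), x] by rewrite in_itv/=; apply/andP; split; lra.
  have tI : t \in `]a + q * (x - a), x] by rewrite in_itv/=; apply/andP; split; lra.
  have xI : x \in `]a + q * (x - a), x] by rewrite in_itv/=; apply/andP; split; lra.
  have sx : s < x by lra.
  have Fsx : F x x < F x s.
    rewrite !FE// subrr mulr0 mulr_gt0// ?mulr_gt0// ?h_gt// subr_gt0.
    by apply: f_incr => //; rewrite in_itv/=; apply/andP; split; lra.
  have : F x t < F x s.
    case: Fmono => mono; last exact: mono.
    by have := mono _ _ sI xI sx; rewrite ltNge (ltW Fsx).
  have hx0 : 0 < h x by exact: h_gt.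
  rewrite /F (gE xab) (gE sab) (gE tab).
  have -> : f x * h x * h t - h x * (f t * h t) = h x * (f x * h t - f t * h t) by ring.
  have -> : f x * h x * h s - h x * (f s * h s) = h x * (f x * h s - f s * h s) by ring.
  by rewrite ltr_pM2l//; lra.
Unshelve. all: by end_near. Qed.

End fixed_g.

(** If f decreases, pass to - g: f and F_x change sign and local extrema are kept. *)
Lemma no_extremum_absurd (g : R -> R) (L : R) :
  {within `[a, b[, continuous g} ->
  (fun x => g x / h x) @ a^'+ --> L ->
  (forall x t, a < x <= d -> a + q * (x - a) < t < x ->
    ~ is_local_extremum `[a, b[%classic (fun t => g x * h t - h x * g t) t) ->
  False.
Proof.
move=> g_cont f_cvg noext.
case: (quotient_strict_monotonic g_cont noext) => [|f_decr].
  exact: (quotient_increasing_absurd g_cont f_cvg).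
have fN : (fun x => (- g x) / h x) = \- (fun x => g x / h x).
  by apply/funext => x; rewrite mulNr.
apply: (@quotient_increasing_absurd (\- g) (- L)).
- by move=> x; apply: continuousN; exact: g_cont.
- by rewrite fN; exact: cvgN.
- move=> x t axd qt ext; apply: (noext _ _ axd qt).
  apply: is_local_extremumN.
  by apply: (@is_local_extremum_shift _ _ _ _ 0 _ _ ext) => s /=; ring.
- by move=> x y xI yI xy; rewrite !mulNr ltrN2 f_decr.
Qed.

End no_extremum.

(** * From local extrema to the upper limits *)

Section limsup.
Context {R : realType} (a b L : R) (h g : R -> R).
Hypothesis ab : a < b.
Hypothesis h_cont : {within `[a, b[, continuous h}.
Hypothesis g_cont : {within `[a, b[, continuous g}.
Hypothesis h_homo : {in `[a, b[ &, {homo h : x y / x <= y}}.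
Hypothesis h_gt : forall x, a < x < b -> h a < h x.
Hypothesis f_cvg : (fun x => (g x - g a) / (h x - h a)) @ a^'+ --> L.

Let F x t := (g x - g a) * h t - (h x - h a) * g t.

Let F_cont x : {within `[a, b[, continuous (F x)}.
Proof.
have /subspace_continuousP hc := h_cont.
have /subspace_continuousP gc := g_cont.
apply/subspace_continuousP => t At; rewrite /F; apply: cvgB.
  by apply: cvgM; [exact: cvg_cst|exact: hc].
by apply: cvgM; [exact: cvg_cst|exact: gc].
Qed.

Lemma C_const_lt (t : R) : (C_const a b h < t%:E)%E ->
  exists s d : R, [/\ s < t, a < d < b &
    {ae (@lebesgue_measure R), forall x, a <= x <= d ->
      derivable h x 1 -> (ess_quot a h x <= s%:E)%E}].
Proof.
by move=> /ereal_inf_lt[_ [s [d adb ae_s] <-]]; rewrite lte_fin; exists s, d.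
Qed.

(** S x stands for either of the sets whose suprema are [mu_fun] and [xi_fun]. An upper limit below
    e ^ (- C) would leave []a + q (x - a), x[] free of extrema of F_x for all x near a, against
    [no_extremum_absurd]. *)
Lemma sup_extrema_limsup_ge (S : R -> set R) :
  (forall x, a < x < b -> S x `<=` `]a, x]) ->
  (forall x t, a < x < b -> a < t < x ->
    is_local_extremum `[a, b[%classic (F x) t -> S x t) ->
  (expeR (- C_const a b h) <=
    limf_esup (fun x => ((sup (S x) - a) / (x - a))%:E) a^'+)%E.
Proof.
move=> S_sub S_ext; rewrite leNgt; apply/negP.
move=> /ereal_inf_lt[_ [V aV <-]]; set M := ereal_sup _ => MC.
have S_ub x : a < x < b -> has_ubound (S x).
  by move=> xab; exists x => t /(S_sub _ xab); rewrite /= in_itv/= => /andP[].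
(* F_x agrees at a and x, so it has an extremum in between and the supremum is not the default value
   of an empty set. *)
have S_ex x : a < x < b -> exists2 t, S x t & a < t.
  move=> /[dup] xab /andP[ax xb].
  have Fax : F x a = F x x by rewrite /F; ring.
  have Fc : {within `[a, x], continuous (F x)}.
    apply: continuous_subspaceW (@F_cont x) => z /=; rewrite !in_itv/=.
    by move=> /andP[-> /le_lt_trans]; apply.
  have [t axt ext] := @eq_ends_local_extremum _ `[a, b[%classic _ _ _ ax Fc Fax.
  by exists t; [exact: S_ext ext|case/andP: axt].
have M_ge x : V x -> (((sup (S x) - a) / (x - a))%:E <= M)%E.
  by move=> Vx; apply: ereal_sup_ubound; exists x.
have M0 : (0 <= M)%E.
  near a^'+ => x.
  have Vx : V x by near: x.
  have ax : a < x by near: x; exact: nbhs_right_gt.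
  have xab : a < x < b by rewrite ax/=; near: x; exact: nbhs_right_lt.
  apply: le_trans (M_ge _ Vx); rewrite lee_fin divr_ge0// subr_ge0 ltW//.
  have [t St at_] := S_ex _ xab.
  by apply: (lt_le_trans at_); apply: ub_le_sup => //; exact: S_ub.
(* For finite C, q is halfway between M and e ^ (- C); C = +oo is impossible as M >= 0. For C = -oo,
   q = M + 1 >= 1, a case ruled out at [q1], where s >= 0 forces q < 1. *)
have [q [q0 Mq qC]] : exists q : R,
    [/\ 0 < q, (M <= q%:E)%E & (C_const a b h < (- ln q)%:E)%E].
  have Mfin : (M < +oo)%E by rewrite (lt_le_trans MC)// leey.
  have ME : M = (fine M)%:E by rewrite fineK// ge0_fin_numE.
  have m0 : 0 <= fine M by rewrite -lee_fin -ME.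
  move: MC; rewrite ME; case: (C_const a b h) => [c| |].
  - rewrite /= lte_fin => mc; exists ((fine M + expR (- c)) / 2); split.
    + by have := expR_gt0 (- c); lra.
    + by rewrite lee_fin; lra.
    + rewrite lte_fin ltrNr -[ltRHS](expRK (- c)) ltr_ln ?posrE ?expR_gt0//; last lra.
      by have := expR_gt0 (- c); lra.
  - by rewrite /= lte_fin ltNge m0.
  - move=> _; exists (fine M + 1); split; [lra|by rewrite lee_fin; lra|].
    exact: ltNyr.
have [s [d [sq adb ae_s]]] := C_const_lt qC.
have s0 := ess_bound_ge0 adb h_cont h_homo h_gt ae_s.
have [r r1 growth] := exponential_growth adb h_cont h_homo h_gt ae_s q0 sq.
have q1 : q < 1.
  by rewrite ltNge; apply/negP => /ln_ge0; lra.
case: aV => e /= e0 VP; case/andP: adb => ad db.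
(* Points of []a, a + e / 2]] belong to V. *)
pose d' := Num.min d (a + e / 2).
have [ad' d'd d'e] : [/\ a < d', d' <= d & d' <= a + e / 2].
  by rewrite /d' lt_min !ge_min !lexx orbT; split=> //; apply/andP; split; lra.
have ad'b : a < d' < b by apply/andP; split; lra.
have q01 : 0 < q < 1 by rewrite q0.
have h0_cont : {within `[a, b[, continuous (fun x => h x - h a)}.
  by move=> x; apply: continuousB; [exact: h_cont|exact: cvg_cst].
have g0_cont : {within `[a, b[, continuous (fun x => g x - g a)}.
  by move=> x; apply: continuousB; [exact: g_cont|exact: cvg_cst].
have h0_homo : {in `[a, b[ &, {homo (fun x => h x - h a) : x y / x <= y}}.
  by move=> x y xI yI xy; rewrite lerD2r h_homo.
have h0_gt x : a < x < b -> 0 < h x - h a.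
  by move=> xab; rewrite subr_gt0 h_gt.
have h0_exp x : a < x <= d' -> (h (a + q * (x - a)) - h a) * expR r < h x - h a.
  by move=> /andP[ax xd]; apply: growth; apply/andP; split; lra.
apply: (no_extremum_absurd ad'b q01 r1 h0_cont h0_homo (subrr _) h0_gt h0_exp
  g0_cont f_cvg).
move=> x t /andP[ax xd] /andP[qt tx] ext.
  have xab : a < x < b by apply/andP; split; lra.
  have Vx : V x.
    by apply: VP => //=; rewrite ltr_norml; apply/andP; split; lra.
  have : (sup (S x) - a) / (x - a) <= q by rewrite -lee_fin (le_trans (M_ge _ Vx)).
  rewrite ler_pdivrMr ?subr_gt0// => supq.
  have qx0 : 0 < q * (x - a) by rewrite mulr_gt0// subr_gt0.
  (* This is absurd, since sup (S x) <= a + q (x - a) < t. *)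
  have : t <= sup (S x).
    apply: ub_le_sup; first exact: S_ub.
    apply: S_ext => //; first by apply/andP; split; lra.
    apply: (@is_local_extremum_shift _ _ _ _
      ((g x - g a) * h a - (h x - h a) * g a) _ _ ext) => u /=.
    by rewrite /F; ring.
  by lra.
Unshelve. all: by end_near. Qed.

End limsup.

Theorem theorem5 (R : realType) (a b : R) (h g : R -> R) :
  a < b ->
  {within `[a, b[, continuous h} ->
  {within `[a, b[, continuous g} ->
  {in `[a, b[ &, forall x y, x <= y -> h x <= h y} ->
  (forall c, a < c <= b -> exists x y, [/\ a <= x < c, a <= y < c & h x != h y]) ->
  (exists L : R, (fun x => (g x - g a) / (h x - h a)) @ a^'+ --> L) ->
  ((expeR (- C_const a b h) <=
      limf_esup (fun x => ((mu_fun a b h g x - a) / (x - a))%:E) a^'+)%E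
   /\
   ((forall t, a < t < b ->
       [/\ derivable h t 1, derivable g t 1 & 0 < derive1 h t]) ->
    (expeR (- C_const a b h) <=
      limf_esup (fun x => ((xi_fun a h g x - a) / (x - a))%:E) a^'+)%E)).
Proof.
move=> ab h_cont g_cont h_homo h_nonconst [L f_cvg].
(* If h x <= h a, monotonicity makes h constant on [[a, x[], contrary to [h_nonconst]. *)
have h_gt x : a < x < b -> h a < h x.
  move=> /andP[ax xb]; rewrite ltNge; apply/negP => hxa.
  have hE u : a <= u < x -> h u = h a.
    move=> /andP[au ux]; apply/eqP; rewrite eq_le; apply/andP; split.
      by apply: le_trans hxa; apply: h_homo; rewrite ?in_itv/=; lra.
    by apply: h_homo; rewrite ?in_itv/=; lra.
  have [|u [v [uI vI]]] := h_nonconst x; first by rewrite ax ltW.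
  by rewrite !hE// eqxx.
split.
  apply: (sup_extrema_limsup_ge ab h_cont g_cont h_homo h_gt f_cvg) => x.
    by move=> _ t [axt _]; rewrite /= in_itv.
  by move=> t _ /andP[at_ tx] ext; split=> //; rewrite at_ ltW.
move=> hg_diff.
apply: (sup_extrema_limsup_ge ab h_cont g_cont h_homo h_gt f_cvg) => x.
  by move=> _ t [/andP[at_ tx] _]; rewrite /= in_itv/= at_ ltW.
move=> t /andP[ax xb] /[dup] axt /andP[at_ tx] ext; split=> //.
(* Fermat's theorem: F'(t) = 0 reads (g x - g a) h'(t) = (h x - h a) g'(t), so t lies in the set
   defining [xi_fun]. *)
set F := fun t : R => _ in ext.
have atb : a < t < b by rewrite at_ (lt_trans tx).
have [dh dg h'0] := hg_diff t atb.
pose c := g x - g a; pose k := h x - h a.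
have dF u : a < u < b -> derivable F u 1.
  by move=> /hg_diff[? ? _]; apply: derivableB; apply: derivableM.
have F'0 : is_derive t 1 F 0.
  (* Cutting the ball of radius e around t down to []a, b[] gives an open interval with both
     differentiability and the comparison of values. *)
  have local e : 0 < e -> exists u v,
      [/\ u <= v, t \in `]u, v[, forall w, w \in `]u, v[ -> derivable F w 1 &
          forall w, w \in `]u, v[ -> `[a, b[%classic w /\ `|w - t| < e].
    move=> e0; exists (Num.max a (t - e)), (Num.min b (t + e)).
    have sub w : w \in `]Num.max a (t - e), Num.min b (t + e)[ =
        (a < w < b) && (t - e < w < t + e).
      by rewrite in_itv/= gt_max lt_min andbACA.
    split.
    - rewrite ge_max !le_min; lra.
    - by rewrite sub atb/=; lra.
    - by move=> w; rewrite sub => /andP[/dF].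
    - move=> w; rewrite sub => /andP[/andP[aw wb] /andP[tw wt]].
      split; first by rewrite /= in_itv/= ltW.
      by rewrite ltr_norml; apply/andP; split; lra.
  case: ext => -[e e0 He]; have [u [v [uv tuv Fuv uve]]] := local e e0.
    by apply: (derive1_at_max uv) => // w /uve[]; exact: He.
  by apply: (derive1_at_min uv) => // w /uve[]; exact: He.
have F'E : is_derive t 1 F (c * derive1 h t - k * derive1 g t).
  have dh1 : is_derive t 1 h (derive1 h t) by apply: DeriveDef; rewrite // derive1E.
  have dg1 : is_derive t 1 g (derive1 g t) by apply: DeriveDef; rewrite // derive1E.
  exact: is_deriveB (is_deriveZ c dh1) (is_deriveZ k dg1).
have cE : c * derive1 h t = k * derive1 g t.
  have := @derive_val _ _ _ _ _ _ _ F'0; rewrite (@derive_val _ _ _ _ _ _ _ F'E).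
  by move/eqP; rewrite subr_eq0 => /eqP.
have k0 : h x - h a != 0 by rewrite subr_eq0 gt_eqF// h_gt// ax.
have h'n0 : derive1 h t != 0 by rewrite gt_eqF.
apply/eqP; rewrite eqr_div//; apply/eqP.
by rewrite [RHS]mulrC; exact: cE.
Qed.
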